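(* Let $C\subset\mathbb R$ be a Cantor set with $d=\operatorname{diam}(C)>0$, whose largest bounded gap $G$ satisfies $|G|\le0.067\,d$, and whose thickness satisfies $$\tau(C)\ge\frac{1-0.067}{2(0.067)}=6.96268\ldots$$ Then for every $0<\theta<1$, $(0,\,0.87\,d]\subseteq G_{P_\theta}(C)$, where $P_\theta=\{0,\theta,1\}$.
   Context: For a finite set $P\subset[0,1]$ and compact $C\subset\mathbb R$, $G_P(C):=\{s>0:\exists x\in\mathbb R\text{ with }x+sP\subset C\}$. A bounded gap of $C$ is a bounded connected component of $\mathbb R\setminus C$, and $|E|=\operatorname{diam}(E)$. Thickness $\tau$: a set $P$ is a chunk of $C$ (written $P\propto C$) if $P=C\cap I$ for some closed interval $I$, $P$ is a nonempty proper subset of $C$, and $d(P,C\setminus P)>0$. If $C$ has a chunk, $\tau(C)=\inf_{P\propto C}|P|/d(P,C\setminus P)$; otherwise $\tau(C)=0$ if $C$ is empty or a single point and $\tau(C)=\infty$ if $C$ is an interval of positive length. (This is equivalent to the usual Newhouse bridge/gap thickness.) *)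

(* Defs.v *)
From HB Require Import structures.
From mathcomp Require Import all_boot all_order all_algebra.
From mathcomp Require Import all_classical all_reals all_analysis.

Set Implicit Arguments.
Unset Strict Implicit.
Unset Printing Implicit Defensive.

Import Order.TTheory GRing.Theory Num.Theory.
Import numFieldNormedType.Exports.

Local Open Scope classical_set_scope.
Local Open Scope ring_scope.

Definition cantor_set (R : realType) (C : set R) : Prop :=
  [/\ C !=set0, compact C, perfect_set C & totally_disconnected C].

(* Since [sup] and [inf] are 0 by convention where they do not exist, [diam E]
   is the true diameter for bounded [E] (and 0 for [E] empty), and
   [set_dist A B] is the true distance for nonempty [A] and [B]. *)
Definition diam (R : realType) (E : set R) : R :=
  sup [set `|x - y| | x in E & y in E].

Definition set_dist (R : realType) (A B : set R) : R :=
  inf [set `|a - b| | a in A & b in B].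

Definition bounded_gap (R : realType) (C G : set R) : Prop :=
  bounded_set G /\
  exists2 x : R, (~` C) x & G = connected_component (~` C) x.

Definition chunk (R : realType) (C P : set R) : Prop :=
  [/\ exists I : set R, [/\ is_interval I, closed I & P = C `&` I],
      P !=set0,
      P `<` C &
      0 < set_dist P (C `\` P)].

(* Meant for compact [C]: the last case, a compact set with at least two points
   and no chunk, is then exactly an interval of positive length. *)
Definition thickness (R : realType) (C : set R) : \bar R :=
  if `[< exists P, chunk C P >] then
    ereal_inf [set (diam P / set_dist P (C `\` P))%:E | P in chunk C]
  else if `[< C = set0 \/ exists x, C = [set x] >] then 0%E
  else +oo%E.

Definition scales (R : realType) (P C : set R) : set R :=
  [set s | 0 < s /\ exists x : R, [set x + s * p | p in P] `<=` C].

(* Main.v *)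
Require Import Defs.
From mathcomp Require Import finmap.
From HB Require Import structures.
From mathcomp Require Import all_boot all_order all_algebra.
From mathcomp Require Import all_classical all_reals all_analysis.
From mathcomp Require Import lra.

Set Implicit Arguments.
Unset Strict Implicit.
Unset Printing Implicit Defensive.

Import Order.TTheory GRing.Theory Num.Theory.
Import numFieldNormedType.Exports.

Local Open Scope classical_set_scope.
Local Open Scope ring_scope.

(** Let [m] and [M] be the extreme points of [C] and [tau = 933/134].  One looks
    for a common point of [C], [C - theta s] and [C - s] in [J = [m, M - s]].
    Call a gap [i]-coloured if it is a gap of the [i]-th of these sets; if there
    is no common point, then by compactness finitely many coloured gaps cover
    [J].  Treat these gaps in order of decreasing length, shrinking [J] each time
    to one of the two sides of the gap.  The ends of [J] then always lie in two
    of the sets, [a] and [b], and thickness forces a later gap of colour [a]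
    (resp. [b]) to be at distance at least [tau] times its length from the left
    (resp. right) end.  If the gap removed has the third colour [c], we keep a
    side of relative length at least 6/25, where the new third colour is [a] or
    [b], so that its gaps were already constrained from the far end of the
    previous [J].  If it has colour [a] or [b], we keep the side of length at
    least [tau] times that of the gap, which dominates all later gaps.  Hence [J]
    never disappears, and the gaps do not cover it. *)

(** * Removal of finitely many coloured gaps from an interval *)

Section ColouredGaps.
Variable R : realFieldType.
Implicit Types (l r : R) (a b c : 'I_3).

Definition coloured_gap : Type := 'I_3 * (R * R).
Implicit Types (g h : coloured_gap) (F : seq coloured_gap).

Local Notation tau := (933 / 134 : R).
Local Notation col g := g.1.
Local Notation lo g := g.2.1.
Local Notation hi g := g.2.2.
Local Notation len g := (g.2.2 - g.2.1).

(* The first disjunct is for gaps lying outside the interval [l, r]. *)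
Definition clear_left l h : bool := (hi h <= l) || (l + tau * len h <= lo h).
Definition clear_right r h : bool := (r <= lo h) || (hi h + tau * len h <= r).

(* The ratio c = 6/25 has to satisfy c (tau (1 - 2c) + 1 - c) >= 1, for the
   condition to pass to the next piece, and 67/1000 <= (1 - 2c) (1 - 87/100),
   for it to hold at the start. *)
Definition leaves_piece l r h : bool :=
  (l + 6 / 25 * (r - l) <= lo h) || (hi h + 6 / 25 * (r - l) <= r).

(** Meant for [g] treated before [h]. Both sides of [g] are constrained, since either end of [g] may
    become an end of the interval. *)
Definition dominates g h : bool :=
  (len h <= len g) &&
  ((col g == col h) ==> clear_left (hi g) h && clear_right (lo g) h).

(* The second alternative occurs after the removal of a gap of colour [a] or
   [b], when both ends get the same colour. *)
Definition admissible a b l r F : Prop :=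
  [/\ l < r, {in F, forall h, col h = a -> clear_left l h},
      {in F, forall h, col h = b -> clear_right r h} &
      (a != b /\
        {in F, forall h, col h != a -> col h != b -> leaves_piece l r h}) \/
      {in F, forall h, tau * len h <= r - l}].

Lemma third_colour a b c (x : 'I_3) :
  a != b -> c != a -> c != b -> x != a -> x != c -> x = b.
Proof.
case: a b c x => [[|[|[|//]]] ia] [[|[|[|//]]] ib] [[|[|[|//]]] ic] [[|[|[|//]]] ix];
  rewrite -!val_eqE //= => *; exact/val_inj.
Qed.

(** Induction on [F], whose head is a longest gap; with no gap left, [l] itself serves. *)
Lemma admissible_uncovered F a b l r :
  {in F, forall h, lo h < hi h} -> pairwise dominates F ->
  admissible a b l r F ->
  exists2 y, l <= y <= r & {in F, forall h, ~~ (lo h < y < hi h)}.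
Proof.
elim: F a b l r => [|g F IH] a b l r Fpos.
  by move=> _ [lr _ _ _]; exists l => //; rewrite lexx ltW.
rewrite pairwise_cons => /andP[/allP gF Fpw] [lr La Rb inv].
have memF h : h \in F -> h \in g :: F by move=> hF; rewrite inE hF orbT.
have g0 : lo g < hi g by apply: Fpos; rewrite mem_head.
have restrict a' b' l' r' : l <= l' -> r' <= r -> (hi g <= l') || (r' <= lo g) ->
    admissible a' b' l' r' F ->
    exists2 y, l <= y <= r & {in g :: F, forall h, ~~ (lo h < y < hi h)}.
  move=> ll' r'r out /(IH _ _ _ _ (fun h hF => Fpos h (memF h hF)) Fpw).
  move=> [y /andP[ly yr] Fy]; exists y; first by lra.
  move=> h; rewrite inE => /predU1P[->|/Fy//].
  by apply/negP => /andP[? ?]; case/orP: out; lra.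
have LaF : {in F, forall h, col h = a -> clear_left l h}.
  by move=> h /memF; apply: La.
have RbF : {in F, forall h, col h = b -> clear_right r h}.
  by move=> h /memF; apply: Rb.
have Lg : {in F, forall h, col h = col g -> clear_left (hi g) h}.
  by move=> h /gF /andP[_ /implyP D] e; have /D/andP[] : col g == col h by rewrite e.
have Rg : {in F, forall h, col h = col g -> clear_right (lo g) h}.
  by move=> h /gF /andP[_ /implyP D] e; have /D/andP[] : col g == col h by rewrite e.
have leng : {in F, forall h, len h <= len g} by move=> h /gF /andP[].
have [hil|lhi] := leP (hi g) l.
  apply: (restrict a b l r); rewrite ?lexx ?hil //; split => //.
  by case: inv => [[ab P]|T];
    [left; split => // h /memF; exact: P|right=> h /memF; exact: T].
have [rlo|lor] := leP r (lo g).
  apply: (restrict a b l r); rewrite ?lexx ?rlo ?orbT //; split => //.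
  by case: inv => [[ab P]|T];
    [left; split => // h /memF; exact: P|right=> h /memF; exact: T].
(* By [clear_left], the left side of [g] has length at least [tau * len g]; its new end also has
   colour [a]. *)
have [ga|ga] := eqVneq (col g) a.
  have /orP[|Lga] := La g (mem_head _ _) ga; first by lra.
  apply: (restrict a a l (lo g)); rewrite ?lexx ?orbT ?(ltW lor) //.
  split => //; [lra | by move=> h /Rg; rewrite ga |].
  by right=> h /leng; lra.
have [gb|gb] := eqVneq (col g) b.
  have /orP[|Rgb] := Rb g (mem_head _ _) gb; first by lra.
  apply: (restrict b b (hi g) r); rewrite ?lexx ?orbT ?(ltW lhi) //.
  split => //; [lra | by move=> h /Lg; rewrite gb |].
  by right=> h /leng; lra.
case: inv => [[ab P]|T].
  have /orP[gl|gr] := P g (mem_head _ _) ga gb.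
    apply: (restrict a (col g) l (lo g)); rewrite ?lexx ?orbT ?(ltW lor) //.
    split => //; first lra.
    left; split; first by rewrite eq_sym.
    (* Unless [h] lies beyond [r], its distance to [r] bounds its length; so if it ends near or
       beyond [lo g], it starts far enough from [l]. *)
    move=> h hF ha hg; have hb := third_colour ab ga gb ha hg.
    have h0 := Fpos h (memF h hF).
    have := RbF h hF hb; rewrite /clear_right /leaves_piece.
    by case/orP => ?; apply/orP; [left; lra|];
      case: (leP (hi h + 6 / 25 * (lo g - l)) (lo g)) => ?; [right|left; lra].
  apply: (restrict (col g) b (hi g) r); rewrite ?lexx ?orbT ?(ltW lhi) //.
  split => //; first lra.
  left; split => //.
  move=> h hF hg hb; have ha : col h = a.
    by apply: (@third_colour b a (col g) (col h)); rewrite // eq_sym.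
  have h0 := Fpos h (memF h hF).
  have := LaF h hF ha; rewrite /clear_left /leaves_piece.
  by case/orP => ?; apply/orP; [right; lra|];
    case: (leP (hi h + 6 / 25 * (r - hi g)) r) => ?; [right|left; lra].
(* As [tau * len g <= r - l], the longer side keeps over 2/5 of the interval, and no later gap is
   long enough to meet both of its outer 6/25 parts. *)
have Tg := T g (mem_head _ _).
have [gl|gr] := leP (r - hi g) (lo g - l).
  apply: (restrict a (col g) l (lo g)); rewrite ?lexx ?orbT ?(ltW lor) //.
  split => //; first lra.
  left; split=> [|h hF _ _]; first by rewrite eq_sym.
  have := leng h hF; rewrite /leaves_piece => ?.
  by case: (leP (hi h + 6 / 25 * (lo g - l)) (lo g)) => ?;
    apply/orP; [right|left; lra].
apply: (restrict (col g) b (hi g) r); rewrite ?lexx ?orbT ?(ltW lhi) //.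
split => //; first lra.
left; split=> [//|h hF _ _].
have := leng h hF; rewrite /leaves_piece => ?.
by case: (leP (hi h + 6 / 25 * (r - hi g)) r) => ?;
  apply/orP; [right|left; lra].
Qed.

(** Separation is available only between distinct gaps, whence the uniqueness of [F]. *)
Lemma pairwise_dominates_sort F : uniq F ->
  {in F &, forall g h, g != h -> col g = col h -> len h <= len g ->
     clear_left (hi g) h && clear_right (lo g) h} ->
  pairwise dominates (sort (fun g h => len h <= len g) F).
Proof.
move=> Funiq Fsep; set leT := (X in sort X F); set s := sort leT F.
have sorted_s : pairwise leT s.
  rewrite -sorted_pairwise; first by apply: sort_sorted => g h; exact: le_total.
  by move=> h g k hg kh; exact: le_trans kh hg.
have neq_s : pairwise [rel g h | g != h] s by rewrite -uniq_pairwise sort_uniq.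
have sF : all (mem F) s by apply/allP => g; rewrite mem_sort.
have := pairwise_relI leT [rel g h | g != h] s; rewrite sorted_s neq_s.
apply: sub_in_pairwise sF => g h gF hF /= /andP[hg gh].
apply/andP; split => //; apply/implyP => /eqP gh_col.
exact: Fsep.
Qed.

End ColouredGaps.

(** * Gaps of a set of reals and the bounds given by thickness *)

Section Gaps.
Variables (R : realType) (C : set R).
Implicit Types (p q x y t : R).

Definition is_gap p q : Prop :=
  [/\ C p, C q, p < q & forall y, p < y < q -> ~ C y].

(** An end of one gap, being in [C], cannot lie inside the other. *)
Lemma is_gap_disjoint p q p' q' :
  is_gap p q -> is_gap p' q' -> [\/ p = p' /\ q = q', q <= p' | q' <= p].
Proof.
move=> [Cp Cq pq npq] [Cp' Cq' pq' npq'].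
have [|qp'] := leP q p'; first by move=> ?; apply: Or32.
have [|q'p] := leP q' p; first by move=> ?; apply: Or33.
apply: Or31; split; apply/eqP; rewrite eq_le !leNgt; apply/andP; split; apply/negP => ?.
- by apply: (npq' p) => //; lra.
- by apply: (npq p') => //; lra.
- by apply: (npq q') => //; lra.
- by apply: (npq' q) => //; lra.
Qed.

(** The ends are the points of [C] nearest to [x] on each side; the upper one is obtained as a
    supremum after reflection. *)
Lemma exists_gap x m M :
  closed C -> C m -> C M -> m <= x <= M -> ~ C x ->
  exists p q, is_gap p q /\ p < x < q.
Proof.
move=> Cc Cm CM /andP[mx xM] nCx.
pose A := C `&` [set y | y <= x].
have A0 : A !=set0 by exists m.
have Aub : ubound A x by move=> y [].
have cA : closed A by apply: closedI => //; exact: closed_le.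
have [CA Ax] : A (sup A).
  by apply: (cA); apply: closure_sup => //; exists x.
pose B' := [set - y | y in C `&` [set y | x <= y]].
have B0 : B' !=set0 by exists (- M), M.
have Bub : ubound B' (- x) by move=> _ [y [_ /= xy] <-]; rewrite lerN2.
have cB : closed B'.
  have -> : B' = -%R @^-1` (C `&` [set y | x <= y]).
    apply/seteqP; split => [_ [y Cy <-]|y Cy] /=; first by rewrite opprK.
    by exists (- y) => //; rewrite opprK.
  apply: closed_comp; first by move=> y _; exact: opp_continuous.
  by apply: closedI => //; exact: closed_ge.
have [q [Cq xq] qE] : B' (sup B').
  by apply: (cB); apply: closure_sup => //; exists (- x).
have neq z : C z -> z != x by move=> Cz; apply/eqP => zx; apply: nCx; rewrite -zx.
have pltx : sup A < x by rewrite lt_neqAle neq.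
have xltq : x < q by rewrite lt_neqAle eq_sym neq.
exists (sup A), q; split; last by rewrite pltx.
split => //; first exact: lt_trans xltq.
move=> y /andP[py yq] Cy.
have [yx|xy] := leP y x.
  by have := ub_le_sup (ex_intro _ x Aub) (conj Cy yx : A y); lra.
have B'y : B' (- y) by exists y => //; split => //; exact: ltW.
by have := ub_le_sup (ex_intro _ (- x) Bub) B'y; rewrite -qE; lra.
Qed.

Lemma is_gap_bounded_gap p q :
  is_gap p q -> exists2 H, bounded_gap C H & q - p <= diam H.
Proof.
move=> [Cp Cq pq npq].
pose x := (p + q) / 2.
have Cx : (~` C) x by apply: npq; rewrite /x; lra.
pose H := connected_component (~` C) x.
have Hx : H x by apply: connected_component_refl.
have Hi : is_interval H by apply/connected_intervalP; exact: component_connected.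
have nHC y : H y -> ~ C y by move=> /connected_component_sub.
have Hpq y : H y -> p < y < q.
  move=> Hy; apply/andP; split; rewrite ltNge; apply/negP => ?.
    by apply: (nHC p) => //; apply: (Hi y x) => //; rewrite /x; lra.
  by apply: (nHC q) => //; apply: (Hi x y) => //; rewrite /x; lra.
have pqH y : p < y < q -> H y.
  have : `]p, q[ `<=` H.
    apply: connected_component_max.
    - by rewrite /= in_itv /= /x; lra.
    - by move=> z /=; rewrite in_itv /=; exact: npq.
    - by apply/connected_intervalP; exact: interval_is_interval.
  by move=> /(_ y) /=; rewrite in_itv.
exists H; first (split; last by exists x).
  exists (`|p| + `|q|); split; first exact: num_real.
  move=> z ltz y /Hpq /andP[py yq] /=.
  apply: le_trans (ltW ltz); rewrite ler_norml.
  have := ler_norm q; have := ler_norm (- p); rewrite normrN.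
  have := normr_ge0 p; have := normr_ge0 q; lra.
(* The supremum is not attained on an open interval, so points at distance [e'] from its ends are
   used. *)
apply/ler_addgt0Pr => e e0.
pose e' := Num.min (e / 2) ((q - p) / 3).
have e'0 : 0 < e' by rewrite lt_min; apply/andP; split; lra.
have e'e : e' <= e / 2 by rewrite ge_min lexx.
have e'pq : e' <= (q - p) / 3 by rewrite ge_min lexx orbT.
have Hd : [set `|x - y| | x in H & y in H] ((q - e') - (p + e')).
  exists (q - e'); first by apply: pqH; lra.
  exists (p + e'); first by apply: pqH; lra.
  by rewrite ger0_norm //; lra.
have : (q - e') - (p + e') <= diam H.
  apply: ub_le_sup Hd; exists (q - p) => _ [y Hy [z Hz <-]].
  have := Hpq y Hy; have := Hpq z Hz; rewrite ler_norml; lra.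
lra.
Qed.

(** The chunk is the part of [C] in [[u, v]]; the point of [C] outside makes it proper and keeps
    [set_dist] from being an infimum over the empty set. *)
Lemma thickness_segment (tau u v e : R) :
  0 <= tau -> (tau%:E <= thickness C)%E -> 0 < e -> C u -> u <= v ->
  (exists2 y, C y & ~~ (u <= y <= v)) ->
  (forall y, C y -> y < u -> y + e <= u) ->
  (forall y, C y -> v < y -> v + e <= y) ->
  tau * e <= v - u.
Proof.
move=> tau0 thickC e0 Cu uv [z Cz zuv] left_far right_far.
pose P := C `&` `[u, v].
have Pu : P u by split=> //=; rewrite in_itv /= lexx.
have Qz : (C `\` P) z by split=> // -[_ /=]; rewrite in_itv /=; exact/negP.
have far : e <= set_dist P (C `\` P).
  apply: lb_le_inf; first by exists `|u - z|, u => //; exists z.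
  move=> _ [x [_ +] [y [Cy nPy] <-]]; rewrite /= in_itv /= => /andP[ux xv].
  have [yu|uy] := ltP y u.
    by have := left_far y Cy yu; rewrite ger0_norm; lra.
  have [vy|yv] := ltP v y.
    by have := right_far y Cy vy; rewrite ler0_norm; lra.
  by exfalso; apply: nPy; split=> //=; rewrite in_itv /= uy.
have small : diam P <= v - u.
  apply: ge_sup; first by exists `|u - u|, u => //; exists u.
  move=> _ [x [_ +] [y [_ +] <-]]; rewrite /= !in_itv /= => /andP[ux xv] /andP[uy yv].
  by rewrite ler_norml; lra.
have chP : chunk C P.
  split; [|by exists u| |exact: lt_le_trans far].
    exists `[u, v]%classic; split => //; first exact: interval_is_interval.
    exact: itv_closed.
  by split=> [x []//|/(_ z Cz) Pz]; case: Qz.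
move: thickC; rewrite /thickness; case: asboolP => [_|[]]; last by exists P.
move=> /le_trans/(_ (ereal_inf_lbound _)) - /(_ _ (ex_intro2 _ _ P chP erefl)).
rewrite lee_fin ler_pdivlMr; last exact: lt_le_trans far.
move=> h; apply: le_trans small; apply: le_trans h.
by rewrite ler_wpM2l.
Qed.

Lemma compact_extrema : C !=set0 -> compact C ->
  exists m M, [/\ C m, C M & forall y, C y -> m <= y <= M].
Proof.
move=> C0 Ccpt.
have idC : {within C, continuous (@id R)}.
  by apply: continuous_subspaceT => x; exact: cvg_id.
have [m Cm mC] := compact_EVT_min C0 Ccpt idC.
have [M CM MC] := compact_EVT_max C0 Ccpt idC.
exists m, M; rewrite !inE in Cm CM; split=> // y; rewrite -inE => Cy.
by rewrite mC ?MC.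
Qed.

Section Thick.
Variable tau : R.
Hypotheses (tau_ge0 : 0 <= tau) (thickC : (tau%:E <= thickness C)%E).

(** Nothing of [C] lies left of [m], so the chunk in [[m, p]] is isolated by this gap alone. *)
Lemma gap_left_bridge p q m : C m -> (forall y, C y -> m <= y) ->
  is_gap p q -> tau * (q - p) <= p - m.
Proof.
move=> Cm mC [Cp Cq pq npq].
apply: (thickness_segment _ thickC _ Cm (mC p Cp)) => //; first by rewrite subr_gt0.
- by exists q => //; apply/negP; lra.
- by move=> y /mC; rewrite leNgt => /negbTE ->.
- move=> y Cy py; have [|yq] := leP q y; first by lra.
  by case: (npq y) => //; rewrite py.
Qed.

Lemma gap_right_bridge p q M : C M -> (forall y, C y -> y <= M) ->
  is_gap p q -> tau * (q - p) <= M - q.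
Proof.
move=> CM MC [Cp Cq pq npq].
apply: (thickness_segment _ thickC _ Cq (MC q Cq)) => //; first by rewrite subr_gt0.
- by exists p => //; apply/negP; lra.
- move=> y Cy yq; have [|py] := leP y p; first by lra.
  by case: (npq y) => //; rewrite py.
- by move=> y /MC; rewrite leNgt => /negbTE ->.
Qed.

(** The chunk in [[q, p']] is isolated by both gaps; [e] is to be the shorter length. *)
Lemma gap_bridge p q p' q' e : is_gap p q -> is_gap p' q' -> q <= p' ->
  0 < e -> e <= q - p -> e <= q' - p' -> tau * e <= p' - q.
Proof.
move=> [Cp Cq pq npq] [Cp' Cq' pq' npq'] qp' e0 eg eg'.
apply: (thickness_segment _ thickC e0 Cq qp') => //.
- by exists p => //; apply/negP; lra.
- move=> y Cy yq; have [|py] := leP y p; first by lra.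
  by case: (npq y) => //; rewrite py.
- move=> y Cy py; have [|yq] := leP q' y; first by lra.
  by case: (npq' y) => //; rewrite py.
Qed.

Lemma gap_separation p q p' q' t : is_gap (p + t) (q + t) ->
  is_gap (p' + t) (q' + t) -> (p, q) != (p', q') -> q' - p' <= q - p ->
  ((q' <= q) || (q + tau * (q' - p') <= p')) &&
  ((p <= p') || (q' + tau * (q' - p') <= p)).
Proof.
move=> g g' neq le_len.
have [_ _ pq _] := g; have [_ _ pq' _] := g'.
have [[/addIr e1 /addIr e2]|qp'|q'p] := is_gap_disjoint g g'.
- by rewrite e1 e2 eqxx in neq.
- have sep : tau * (q' - p') <= p' + t - (q + t).
    by apply: (gap_bridge g g') => //; lra.
  by apply/andP; split; apply/orP; [right|left]; lra.
- have sep : tau * (q' - p') <= p + t - (q' + t).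
    by apply: (gap_bridge g' g) => //; lra.
  by apply/andP; split; apply/orP; [left|right]; lra.
Qed.

End Thick.

End Gaps.

(** * A common point of three translates of the Cantor set *)

Theorem corollary4p2 (R : realType) (C G : set R) (d : R)
    (C_cantor : cantor_set C)
    (diamC : diam C = d) (d_gt0 : 0 < d)
    (G_gap : bounded_gap C G)
    (G_largest : forall G' : set R, bounded_gap C G' -> diam G' <= diam G)
    (G_small : diam G <= 67 / 1000 * d)
    (C_thick : (((1 - 67 / 1000) / (2 * (67 / 1000)))%:E <= thickness C)%E)
    (theta : R) (theta_gt0 : 0 < theta) (theta_lt1 : theta < 1) :
  `]0, 87 / 100 * d] `<=` scales [set 0; theta; 1] C.
Proof.
have [C0 Ccpt _ _] := C_cantor.
have Ccl : closed C by apply: compact_closed => //; exact: Rhausdorff.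
have {C_thick} thickC : ((933 / 134)%:E <= thickness C)%E.
  apply: le_trans C_thick; rewrite lee_fin; lra.
have [m [M [Cm CM CmM]]] := compact_extrema C0 Ccpt.
have mC y : C y -> m <= y by case/CmM/andP.
have MC y : C y -> y <= M by case/CmM/andP.
have {diamC} dmM : d <= M - m.
  rewrite -diamC; apply: ge_sup; first by exists `|m - m|, m => //; exists m.
  move=> _ [x Cx [y Cy <-]].
  have /andP[? ?] := CmM x Cx; have /andP[? ?] := CmM y Cy.
  by rewrite ler_norml; lra.
have {G_gap G_largest G_small} gap_len p q : is_gap C p q -> q - p <= 67 / 1000 * d.
  by case/is_gap_bounded_gap => H /G_largest ? ?; lra.
have tau_ge0 : 0 <= 933 / 134 :> R by lra.
have gap_left p q := @gap_left_bridge R C _ tau_ge0 thickC p q m Cm mC.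
have gap_right p q := @gap_right_bridge R C _ tau_ge0 thickC p q M CM MC.
move=> s /=; rewrite in_itv /= => /andP[s0 sd]; split => //.
(* Colour [i] stands for the translate of [C] by [- t i]. *)
pose t (i : 'I_3) : R :=
  if i == 0 :> nat then 0 else if i == 1 :> nat then theta * s else s.
have t_itv i : 0 <= t i <= s.
  rewrite /t; case: ifP => _; first by rewrite lexx ltW.
  case: ifP => _; last by rewrite lexx ltW.
  by rewrite mulr_ge0 ?ger_pMl // ltW.
suff [y Cy] : exists y, forall i, C (y + t i).
  exists y => _ [p P <-].
  have C1 : C (y + 0) := Cy (@Ordinal 3 0 isT).
  have C2 : C (y + theta * s) := Cy (@Ordinal 3 1 isT).
  have C3 : C (y + s) := Cy (@Ordinal 3 2 isT).
  by case: P => [[->|->]|->]; rewrite ?mulr0 ?mulr1 // mulrC.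
apply: contrapT => noy.
pose D := [set g : coloured_gap R | is_gap C (g.2.1 + t g.1) (g.2.2 + t g.1)].
have cover_J : `[m, M - s] `<=` \bigcup_(g in D) `]g.2.1, g.2.2[%classic.
  move=> y /=; rewrite in_itv /= => /andP[my yM].
  have [i nCi] : exists i, ~ C (y + t i) by apply/existsNP => Cy; apply: noy; exists y.
  have /andP[ti0 tis] := t_itv i.
  have [|p [q [pq /andP[py yq]]]] := exists_gap Ccl Cm CM _ nCi; first lra.
  exists (i, (p - t i, q - t i)); rewrite /D /= ?subrK // in_itv /=; lra.
have cptJ : cover_compact `[m, M - s]%classic.
  by rewrite -compact_cover; exact: segment_compact.
have [|F FD FJ] := cptJ _ D (fun g => `]g.2.1, g.2.2[%classic) _ cover_J.
  by move=> g _; exact: itv_open.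
have Dpos g : D g -> g.2.1 < g.2.2 by case=> _ _; rewrite ltrD2r.
have FDP g : g \in F -> D g by move=> /FD; rewrite inE.
have sepF : {in enum_fset F &, forall g h, g != h -> g.1 = h.1 ->
    h.2.2 - h.2.1 <= g.2.2 - g.2.1 -> clear_left g.2.2 h && clear_right g.2.1 h}.
  move=> [i [p q]] [j [p' q']] /FDP gD /FDP hD; rewrite /D /= in gD hD * => gh ij; subst j.
  move=> len_le; apply: (gap_separation tau_ge0 thickC gD hD) => //.
  by apply: contra_neq gh => ->.
have memF h : (h \in sort (fun g h : coloured_gap R => h.2.2 - h.2.1 <= g.2.2 - g.2.1) F) -> D h.
  by rewrite mem_sort => /FDP.
(* The ends are the minimum of [C] and the maximum of [C - s], so colours 0 and 2 are constrained
   there by the outer bridges. *)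
have [] := @admissible_uncovered R _ (@Ordinal 3 0 isT) (@Ordinal 3 2 isT) m (M - s)
  _ (pairwise_dominates_sort (fset_uniq F) sepF).
- by move=> h /memF /Dpos.
- split; first lra.
  + move=> [i [p q]] /memF + /= ei; subst i; rewrite /D /= /t /= !addr0 => /gap_left ?.
    by rewrite /clear_left /=; apply/orP; right; lra.
  + move=> [i [p q]] /memF + /= ei; subst i; rewrite /D /= /t /= => /gap_right ?.
    by rewrite /clear_right /=; apply/orP; right; lra.
  (* The interval has length at least [13 / 100 * d], and its middle 13/25 is longer than any
     gap. *)
  + left; split => // h /memF hD _ _; have := gap_len _ _ hD.
    rewrite /leaves_piece => ?.
    by case: (leP (h.2.2 + 6 / 25 * (M - s - m)) (M - s)) => ?; apply/orP; [right|left; lra].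
move=> y yJ nF; have [|g gF] := FJ y; first by rewrite /= in_itv.
by rewrite /= in_itv /=; apply/negP/nF; rewrite mem_sort.
Qed.
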